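(* Let $\mathbb{K}$ be $\mathbb{R}$ or $\mathbb{C}$, let $\alpha\in\mathbb{K}$ be a primitive $p$-th root of unity, and consider the $\mathcal{C}^1$-map $F:\mathbb{K}^2\to\mathbb{K}^2$, $$F(x,y)=\left(\alpha x+f(y),\,y/\alpha\right),$$ with $f(0)=f'(0)=0$. Then: (i) $F$ is periodic if and only if $$\sum_{j=0}^{p-1}\alpha^j f(\alpha^j y)\equiv 0,$$ and then it is $p$-periodic. (ii) If $F$ is $p$-periodic, the map $$\psi(\mathbf{x})=\frac1p\sum_{j=0}^{p-1}(DF(0,0))^{-j}\,F^j(\mathbf{x})$$ is a global linearization of $F$, that is, $\psi$ is a diffeomorphism of $\mathbb{K}^2$ onto itself with $\psi\circ F=DF(0,0)\circ\psi$ on $\mathbb{K}^2$.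
   Context: $F^j$ denotes the $j$-th iterate of $F$. A map $F$ is called periodic if for some positive integer $q$ one has $F^q(x)=x$ for all $x$ for which $F^q$ is well defined; it is called $p$-periodic if $p$ is the smallest positive integer with this property. *)

(* Defs.v *)
From mathcomp Require Import all_boot all_order all_algebra.
From mathcomp Require Import complex.
From mathcomp Require Import all_classical all_reals all_analysis.

Set Implicit Arguments.
Unset Strict Implicit.
Unset Printing Implicit Defensive.

Import Order.TTheory GRing.Theory Num.Theory.
Import numFieldNormedType.Exports.

Local Open Scope classical_set_scope.
Local Open Scope ring_scope.

(* [K] carries its own norm and ['rV[K]_n] is normed over [K]: differentiability
   is [K]-differentiability, i.e. complex differentiability when [K] is [R[i]]. *)
Definition real_or_complex (R : realType) (K : numFieldType) : Prop :=
  K = R :> numFieldType \/ K = R[i] :> numFieldType.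

(* [jacobian F v] acts on row vectors from the right: ['d F v w = w *m 'J F v]. *)
Definition C1 (K : numFieldType) (m n : nat) (F : 'rV[K]_m -> 'rV[K]_n) : Prop :=
  (forall v, differentiable F v) /\ continuous (jacobian F).

Definition C1_diffeomorphism (K : numFieldType) (n : nat)
    (psi : 'rV[K]_n -> 'rV[K]_n) : Prop :=
  C1 psi /\
  exists phi : 'rV[K]_n -> 'rV[K]_n,
    [/\ cancel psi phi, cancel phi psi & C1 phi].

(* Only total maps are considered, so every iterate is defined everywhere. *)
Definition is_periodic (T : Type) (F : T -> T) : Prop :=
  exists q : nat, (0 < q)%N /\ forall x, iter q F x = x.

Definition periodic_of_period (T : Type) (F : T -> T) (p : nat) : Prop :=
  [/\ (0 < p)%N,
      (forall x, iter p F x = x) &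
      forall q : nat, (0 < q)%N -> (forall x, iter q F x = x) -> (p <= q)%N].

Definition planar_map (K : numFieldType) (alpha : K) (f : K -> K)
    (v : 'rV[K]_2) : 'rV[K]_2 :=
  let x := v 0 0 in let y := v 0 1 in
  \row_(i < 2) (if i == 0 then alpha * x + f y else y / alpha).

(* The linear maps [DF(0)^{-j}] are applied by right multiplication by
   [('J F 0) ^- j]. *)
Definition averaged_map (K : numFieldType) (n : nat) (p : nat)
    (F : 'rV[K]_n.+1 -> 'rV[K]_n.+1) (v : 'rV[K]_n.+1) : 'rV[K]_n.+1 :=
  p%:R^-1 *: \sum_(j < p) (iter j F v *m jacobian F 0 ^- j).

Definition global_linearization (K : numFieldType) (n : nat)
    (F psi : 'rV[K]_n -> 'rV[K]_n) : Prop :=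
  C1_diffeomorphism psi /\ forall v, psi (F v) = 'd F (0 : 'rV[K]_n) (psi v).

(* Main.v *)
(* Write A = DF(0) = diag(alpha, 1/alpha). The shears (x, y) |-> (x + g(y), y)
   form a group normalised by A, and F is A after the shear by f/alpha. Hence
   F^n is A^n after the shear by T_n(y) = sum_(i < n) alpha^(-i-1) f(alpha^(-i) y).
   Since A^p = 1, F^p is the shear by T_p, and T_p is alpha^(-1) times the sum in
   (i). If F^q is the identity then alpha^q = 1, so q = m p and m T_p = 0. Finally
   A^(-j) F^j is the shear by T_j, so psi is the shear by the average of the T_j;
   its inverse is the opposite shear. *)
Require Import Defs.
From HB Require Import structures.
From mathcomp Require Import all_boot all_order all_algebra.
From mathcomp Require Import complex.
From mathcomp Require Import all_classical all_reals all_analysis.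
Import Order.TTheory GRing.Theory Num.Theory.
Import numFieldNormedType.Exports.
Local Open Scope classical_set_scope.
Local Open Scope ring_scope.

(** * Scalar functions of class C^1 *)

(* The derivative is given through ['d g y] rather than [derive1], since the
   chain rule for [derive1] requires a real field. *)
Definition scalar_C1 {K : numFieldType} (g : K -> K) : Prop :=
  exists2 g' : K -> K,
    forall y, is_diff y g (fun h => h * g' y) & continuous g'.

Lemma scalar_C1_scale {K : numFieldType} (c d : K) (g : K -> K) :
  scalar_C1 g -> scalar_C1 (fun y => c * g (d * y)).
Proof.
case=> g' dg cg'; exists (fun y => c * (d * g' (d * y))).
  move=> y.
  have dd := is_diff_scaler d y.
  have dc := is_diff_scaler c (g (d * y)).
  apply: (is_diff_eq (is_diff_comp (is_diff_comp dd (dg (d * y))) dc)).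
  apply/funext => h /=; rewrite /GRing.scale /= [d * h]mulrC -!mulrA.
  by rewrite mulrCA.
move=> y.
have cgd : {for y, continuous (g' \o *%R d)}.
  by apply: continuous_comp; [exact: mulrl_continuous | exact: cg'].
exact: cvgM (cvg_cst c) (cvgM (cvg_cst d) cgd).
Qed.

Lemma scalar_C1_sum {K : numFieldType} (n : nat) (g : nat -> K -> K) :
  (forall i, scalar_C1 (g i)) -> scalar_C1 (fun y => \sum_(i < n) g i y).
Proof.
move=> C1g; elim: n => [|n [s' ds cs']].
  exists (cst 0) => [y|]; last exact: cst_continuous.
  have -> : (fun y0 => \sum_(i < 0) g i y0) = cst (0 : K).
    by apply/funext => z; rewrite big_ord0.
  apply: (is_diff_eq (is_diff_cst 0 y)).
  by apply/funext => h; rewrite mulr0.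
have [g' dg cg'] := C1g n.
exists (fun y => s' y + g' y) => [y|y]; last exact: cvgD (cs' y) (cg' y).
have -> : (fun y0 => \sum_(i < n.+1) g i y0)
    = (fun y0 => \sum_(i < n) g i y0) + g n.
  by apply/funext => z; rewrite big_ord_recr.
apply: (is_diff_eq (is_diffD (ds y) (dg y))).
by apply/funext => h; rewrite mulrDr.
Qed.

(** * Differentials and Jacobians of maps on row vectors *)

Lemma is_diff_coord {K : numFieldType} (m n : nat) (v : 'M[K]_(m, n)) i j :
  is_diff v (fun w : 'M[K]_(m, n) => w i j) (fun w : 'M[K]_(m, n) => w i j).
Proof.
have lin : linear (fun w : 'M[K]_(m, n) => w i j).
  by move=> a u w; rewrite !mxE.
pose L : {linear 'M[K]_(m, n) -> K} :=
  HB.pack (fun w : 'M[K]_(m, n) => w i j) (GRing.isLinear.Build _ _ _ _ _ lin).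
have cL : continuous L by exact: coord_continuous.
have -> : (fun w : 'M[K]_(m, n) => w i j) = L by [].
by apply: DiffDef; [exact: linear_differentiable | rewrite diff_lin].
Qed.

(** The product is a combination of the fixed rows of [M] with the coordinates of [v] as
    coefficients, so continuity of coordinates suffices. *)
Lemma mulmxr_continuous {K : numFieldType} (m n : nat) (M : 'M[K]_(m, n)) :
  continuous (fun v : 'rV[K]_m => v *m M).
Proof.
have -> : (fun v : 'rV[K]_m => v *m M)
    = (fun v : 'rV[K]_m => \sum_i v 0 i *: row i M).
  by apply/funext => w; rewrite mulmx_sum_row.
elim: (index_enum _) => [|i s IHs].
  have -> : (fun v : 'rV[K]_m => \sum_(i <- [::]) v 0 i *: row i M) = cst 0.
    by apply/funext => w; rewrite big_nil.
  exact: cst_continuous.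
have -> : (fun v : 'rV[K]_m => \sum_(j <- i :: s) v 0 j *: row j M)
    = (fun v => v 0 i *: row i M + \sum_(j <- s) v 0 j *: row j M).
  by apply/funext => w; rewrite big_cons.
move=> v.
have ci : (fun w : 'rV[K]_m => w 0 i) @ v --> v 0 i by exact: coord_continuous.
exact: cvgD (cvgZr_tmp ci) (IHs v).
Qed.

Lemma is_diff_mulmxr {K : numFieldType} (m n : nat) (M : 'M[K]_(m, n))
    (v : 'rV[K]_m) :
  is_diff v (fun w : 'rV[K]_m => w *m M) (fun w : 'rV[K]_m => w *m M).
Proof.
have cM : continuous (mulmxr M : 'rV[K]_m -> _) := mulmxr_continuous m n M.
have -> : (fun w : 'rV[K]_m => w *m M) = mulmxr M by [].
by apply: DiffDef; [exact: linear_differentiable | rewrite diff_lin].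
Qed.

Lemma jacobian_is_diff {K : numFieldType} (m n : nat)
    (F : 'rV[K]_m -> 'rV[K]_n) (v : 'rV[K]_m) (M : 'M[K]_(m, n)) :
  is_diff v F (fun w : 'rV[K]_m => w *m M) -> jacobian F v = M.
Proof.
move=> dF; apply/row_matrixP => i.
by rewrite 2!rowE mul_rV_lin1 /= diff_val.
Qed.

(** * The group of shears *)

Definition shear {K : numFieldType} (g : K -> K) (v : 'rV[K]_2) : 'rV[K]_2 :=
  v + g (v 0 1) *: delta_mx 0 0.

Lemma shear_snd {K : numFieldType} (g : K -> K) (v : 'rV[K]_2) :
  shear g v 0 1 = v 0 1.
Proof. by rewrite /shear !mxE /= mulr0 addr0. Qed.

Lemma shear_add {K : numFieldType} (g h : K -> K) (v : 'rV[K]_2) :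
  shear g (shear h v) = shear (fun y => h y + g y) v.
Proof. by rewrite {1}/shear shear_snd /shear -addrA -scalerDl. Qed.

Lemma shear0 {K : numFieldType} (g : K -> K) (v : 'rV[K]_2) :
  g (v 0 1) = 0 -> shear g v = v.
Proof. by rewrite /shear => ->; rewrite scale0r addr0. Qed.

(** Matrices act on row vectors from the right, so the influence of the second coordinate on the
    first sits in the entry (1, 0). *)
Lemma is_diff_shear {K : numFieldType} (g : K -> K) (a : K) (v : 'rV[K]_2) :
  is_diff (v 0 1) g (fun h => h * a) ->
  is_diff v (shear g)
    (fun w : 'rV[K]_2 => w *m (1%:M + a *: (delta_mx 1 0 : 'M[K]_2))).
Proof.
move=> dg.
have dcomp := is_diff_comp (is_diff_comp (is_diff_coord 1 2 v 0 1) dg)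
  (is_diff_scalel (g (v 0 1)) (delta_mx 0 0 : 'rV[K]_2)).
apply: (is_diff_eq (is_diffD (is_diff_id v) dcomp)).
apply/funext => w /=; rewrite mulmxDr mulmx1; congr (w + _).
apply/rowP => j; rewrite -scalemxAr !mxE /= (bigD1 1) //= big1 => [|i /negPf i1].
  by rewrite !mxE eqxx addr0 mulrCA mulrA.
by rewrite mxE i1 mulr0.
Qed.

Lemma C1_shear {K : numFieldType} (g : K -> K) : scalar_C1 g -> C1 (shear g).
Proof.
case=> g' dg cg'; split=> [v|].
  by have [] := is_diff_shear g (g' (v 0 1)) v (dg _).
have -> : jacobian (shear g)
    = fun v : 'rV[K]_2 => 1%:M + g' (v 0 1) *: (delta_mx 1 0 : 'M[K]_2).
  apply/funext => v; exact: jacobian_is_diff (is_diff_shear g _ v (dg _)).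
move=> v.
have cg1 : {for v, continuous (g' \o (fun w : 'rV[K]_2 => w 0 1))}.
  by apply: continuous_comp; [exact: coord_continuous | exact: cg'].
exact: cvgD (cvg_cst _) (cvgZr_tmp cg1).
Qed.

(** * The linear part and the iterates of the map *)

Definition planar_linear_part {K : numFieldType} (alpha : K) : 'M[K]_2 :=
  diag_mx (\row_(i < 2) (if i == 0 then alpha else alpha^-1)).

Lemma planar_linear_part1 {K : numFieldType} : planar_linear_part (1 : K) = 1.
Proof.
by apply/matrixP => i j; rewrite !mxE invr1 if_same eq_sym.
Qed.

Lemma expmx_planar_linear_part {K : numFieldType} (alpha : K) (n : nat) :
  planar_linear_part alpha ^+ n = planar_linear_part (alpha ^+ n).
Proof.
elim: n => [|n IHn]; first by rewrite !expr0 planar_linear_part1.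
rewrite exprS IHn -mulmxE mulmx_diag; congr diag_mx.
by apply/rowP => i; rewrite !mxE; case: ifP; rewrite exprS ?invfM.
Qed.

Lemma mul_planar_linear_part {K : numFieldType} (alpha : K) (v : 'rV[K]_2) i :
  (v *m planar_linear_part alpha) 0 i
    = v 0 i * (if i == 0 then alpha else alpha^-1).
Proof. by rewrite mul_mx_diag !mxE. Qed.

(** The shear comes first, so [f] is divided by [alpha] in advance to undo the later multiplication
    of the first coordinate by [alpha]. *)
Lemma planar_mapE {K : numFieldType} (alpha : K) (f : K -> K) (v : 'rV[K]_2) :
  alpha != 0 ->
  planar_map alpha f v
    = shear (fun y => alpha^-1 * f y) v *m planar_linear_part alpha.
Proof.
move=> a0; apply/rowP => i; rewrite mul_planar_linear_part !mxE eqxx /=.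
case: eqP => [->|/eqP i0].
  by rewrite mulr1 mulrDl mulrC mulrAC mulVf // mul1r.
have -> : i = 1 by apply/val_inj; case: i i0 => [[|[|]]].
by rewrite mulr0 addr0.
Qed.

(** The linear part normalises the shears: moved to the inside, [h] reads the second coordinate
    before its division by [alpha], and its value is still to be multiplied by [alpha]. *)
Lemma shear_mul_planar_linear_part {K : numFieldType} (alpha : K) (h : K -> K)
    (v : 'rV[K]_2) : alpha != 0 ->
  shear h (v *m planar_linear_part alpha)
    = shear (fun y => alpha^-1 * h (y / alpha)) v *m planar_linear_part alpha.
Proof.
move=> a0; rewrite /shear mul_planar_linear_part /= mulmxDl; congr (_ + _).
apply/rowP => i; rewrite mul_planar_linear_part !mxE eqxx /=.
case: eqP => _; last by rewrite !mulr0 mul0r.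
by rewrite !mulr1 mulrAC mulVf // mul1r.
Qed.

(* The shear S_n for which F^n = DF(0)^n o S_n. *)
Definition planar_shift {K : numFieldType} (alpha : K) (f : K -> K) (n : nat)
    (y : K) : K :=
  \sum_(i < n) (alpha ^- i.+1 * f (alpha ^- i * y)).

(** One more application of the map contributes the shear by [f] over [alpha]; moving it inside the
    [n]-th power of the linear part gives exactly the summand of index [n]. *)
Lemma iter_planar_map {K : numFieldType} (alpha : K) (f : K -> K) (n : nat)
    (v : 'rV[K]_2) : alpha != 0 ->
  iter n (planar_map alpha f) v
    = shear (planar_shift alpha f n) v *m planar_linear_part alpha ^+ n.
Proof.
move=> a0; elim: n => [|n IHn].
  by rewrite expr0 mulmx1 shear0 // /planar_shift big_ord0.
rewrite iterS IHn planar_mapE // expmx_planar_linear_part.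
rewrite shear_mul_planar_linear_part ?expf_neq0 // -mulmxA shear_add.
rewrite -expmx_planar_linear_part mulmxE -exprSr; congr (shear _ v *m _).
apply/funext => y; rewrite /planar_shift big_ord_recr /= mulrA [y / _]mulrC.
by rewrite exprS invfM [alpha^-1 * _]mulrC.
Qed.

(** * Iterates over a full period *)

Lemma sum_cyclic_shift {V : nmodType} (p : nat) (h : nat -> V) :
  h p = h 0%N -> \sum_(i < p) h i.+1 = \sum_(i < p) h i.
Proof.
case: p => [|p] hp; first by rewrite !big_ord0.
by rewrite big_ord_recr big_ord_recl /= hp addrC.
Qed.

Lemma prim_root_neq0 {K : fieldType} (p : nat) (alpha : K) :
  p.-primitive_root alpha -> alpha != 0.
Proof. by move=> pa; rewrite (prim_root_eq0 pa) -lt0n (prim_order_gt0 pa). Qed.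

Lemma planar_shift_period {K : numFieldType} (p : nat) (alpha : K) (f : K -> K)
    (y : K) : p.-primitive_root alpha ->
  planar_shift alpha f p y
    = alpha^-1 * \sum_(j < p) alpha ^+ j * f (alpha ^+ j * y).
Proof.
move=> pa; have a0 := prim_root_neq0 p alpha pa.
(* With exponents running over 1..p, reversing the order yields the exponents [p - i], which agree
   with [- i] because alpha^p = 1. *)
rewrite -(@sum_cyclic_shift _ p (fun j => alpha ^+ j * f (alpha ^+ j * y))); last first.
  by rewrite (prim_expr_order pa).
rewrite mulr_sumr [RHS](reindex_inj rev_ord_inj); apply: eq_bigr => i _ /=.
have -> : alpha ^+ (p - i.+1).+1 = alpha ^- i.
  rewrite subnSK // expfB_cond ?(negPf a0) ?(ltnW (ltn_ord i)) //.
  by rewrite (prim_expr_order pa) mul1r.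
by rewrite mulrA exprS invfM.
Qed.

Lemma iter_shear {K : numFieldType} (g : K -> K) (m : nat) (v : 'rV[K]_2) :
  iter m (shear g) v = shear (fun y => g y *+ m) v.
Proof.
elim: m => [|m IHm]; first by rewrite shear0.
by rewrite iterS IHm shear_add; congr shear; apply/funext => y; rewrite mulrSr.
Qed.

Lemma iter_planar_map_period {K : numFieldType} (p : nat) (alpha : K)
    (f : K -> K) (m : nat) (v : 'rV[K]_2) : p.-primitive_root alpha ->
  iter (m * p) (planar_map alpha f) v
    = shear (fun y => planar_shift alpha f p y *+ m) v.
Proof.
move=> pa; have a0 := prim_root_neq0 p alpha pa.
rewrite iterM -iter_shear; apply: eq_iter => w; rewrite iter_planar_map //.
by rewrite expmx_planar_linear_part (prim_expr_order pa) planar_linear_part1 mulmx1.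
Qed.

Lemma planar_map_period_dvd {K : numFieldType} (p : nat) (alpha : K)
    (f : K -> K) (q : nat) : p.-primitive_root alpha ->
  (forall v, iter q (planar_map alpha f) v = v) -> (p %| q)%N.
Proof.
move=> pa Fq; have a0 := prim_root_neq0 p alpha pa.
(* Shears fix the second coordinate, so at (0, 1) the fixed-point equation reduces to alpha^(-q) =
   1. *)
have /(congr1 (fun w : 'rV_2 => w 0 1)) := Fq (delta_mx 0 1).
rewrite iter_planar_map // expmx_planar_linear_part mul_planar_linear_part /=.
rewrite shear_snd mxE !eqxx mul1r (prim_order_dvd pa) => /(congr1 GRing.inv).
by rewrite invrK invr1 => ->.
Qed.

(** * Regularity of [f] and the differential at the origin *)

Lemma jacobianE {K : numFieldType} (m n : nat) (F : 'rV[K]_m -> 'rV[K]_n)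
    (v : 'rV[K]_m) i j : jacobian F v i j = 'd F v (delta_mx 0 i) 0 j.
Proof. by rewrite /jacobian /lin1_mx mxE. Qed.

(** On the line x = 0 the first coordinate of the map is [f], so the derivative of [f] is the entry
    (1, 0) of the Jacobian along this line. *)
Lemma scalar_C1_planar_map {K : numFieldType} (alpha : K) (f : K -> K) :
  C1 (planar_map alpha f) -> scalar_C1 f.
Proof.
case=> dF cJ; pose e1 : 'rV[K]_2 := delta_mx 0 1.
exists (fun y => jacobian (planar_map alpha f) (y *: e1) 1 0) => y.
  have dFy := DiffDef (Phantom _ (nbhs (y *: e1))) (dF (y *: e1)) erefl.
  have dcomp := is_diff_comp (is_diff_comp (is_diff_scalel y e1) dFy)
    (is_diff_coord 1 2 (planar_map alpha f (y *: e1)) 0 0).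
  have fE : (fun w : 'rV[K]_2 => w 0 0) \o (planar_map alpha f \o *:%R^~ e1) = f.
    by apply/funext => z; rewrite /= !mxE /= mulr0 mulr0 add0r mulr1.
  rewrite fE in dcomp; apply: (is_diff_eq dcomp).
  by apply/funext => h /=; rewrite linearZ mxE jacobianE.
have ce : {for y, continuous ( *:%R^~ e1 : K -> 'rV[K]_2)} by exact: scalel_continuous.
have cJe : {for y, continuous (jacobian (planar_map alpha f) \o *:%R^~ e1)}.
  exact: continuous_comp ce (cJ _).
have c10 : {for jacobian (planar_map alpha f) (y *: e1),
    continuous (fun M : 'M[K]_2 => M 1 0)} by exact: coord_continuous.
exact: continuous_comp cJe c10.
Qed.

(** Since f'(0) = 0, the shear factor is tangent to the identity at the origin and only the linear
    factor survives. *)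
Lemma is_diff_planar_map0 {K : numFieldType} (alpha : K) (f : K -> K) :
  alpha != 0 -> scalar_C1 f -> derive1 f 0 = 0 ->
  is_diff (0 : 'rV[K]_2) (planar_map alpha f)
    (fun w : 'rV[K]_2 => w *m planar_linear_part alpha).
Proof.
move=> a0 [f' df _] f'0.
have f'00 : f' 0 = 0.
  by have [dif val] := df 0; rewrite (derive1E' dif) val mul1r in f'0.
have dg : is_diff ((0 : 'rV[K]_2) 0 1) (fun y => alpha^-1 * f y) (fun h => h * 0).
  rewrite mxE; have ds := is_diff_scaler alpha^-1 (f 0).
  apply: (is_diff_eq (is_diff_comp (df 0) ds)).
  by apply/funext => h /=; rewrite f'00 !mulr0 scaler0.
have -> : planar_map alpha f = (fun w : 'rV[K]_2 => w *m planar_linear_part alpha)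
    \o shear (fun y => alpha^-1 * f y).
  by apply/funext => v; exact: planar_mapE.
apply: (is_diff_eq (is_diff_comp (is_diff_shear _ 0 0 dg) (is_diff_mulmxr 2 2 _ _))).
by apply/funext => w /=; rewrite scale0r addr0 mulmx1.
Qed.

(** * The averaged map *)

Lemma planar_linear_part_unit {K : numFieldType} (alpha : K) :
  alpha != 0 -> planar_linear_part alpha \is a GRing.unit.
Proof.
move=> a0; suff /mulmx1_unit[]:
  planar_linear_part alpha *m planar_linear_part alpha^-1 = 1%:M by [].
apply/matrixP => i j; rewrite mulmx_diag !mxE eq_sym.
by case: ifP => _; rewrite ?mulfV ?invr_eq0.
Qed.

(** In each term the powers of the linear part cancel and leave a shear. The [p] copies of [v]
    average to [v], as [p] is invertible in [K]. *)
Lemma averaged_planar_map {K : numFieldType} (p : nat) (alpha : K) (f : K -> K) :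
  (0 < p)%N -> alpha != 0 -> jacobian (planar_map alpha f) 0 = planar_linear_part alpha ->
  averaged_map p (planar_map alpha f)
    = shear (fun y => p%:R^-1 * \sum_(j < p) planar_shift alpha f j y).
Proof.
move=> p0 a0 J0; apply/funext => v.
rewrite /averaged_map J0.
under eq_bigr => j _.
  rewrite iter_planar_map // -mulmxA mulmxE mulrV ?mulmx1; last first.
    by rewrite unitrX ?planar_linear_part_unit.
  over.
rewrite /shear big_split /= sumr_const card_ord -scaler_suml scalerDr.
by rewrite scalerA -[v *+ p]scaler_nat scalerA mulVf ?scale1r // pnatr_eq0 -lt0n.
Qed.

(** Replacing [v] by [F v] raises the iterate in each term by one; factoring out the Jacobian raises
    its inverse power likewise. The sum over 1..p equals that over 0..p-1 because the terms of index
    0 and [p] agree. *)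
Lemma averaged_map_conj {K : numFieldType} (n p : nat)
    (F : 'rV[K]_n.+1 -> 'rV[K]_n.+1) (v : 'rV[K]_n.+1) :
  jacobian F 0 \is a GRing.unit -> jacobian F 0 ^+ p = 1 -> iter p F v = v ->
  averaged_map p F (F v) = averaged_map p F v *m jacobian F 0.
Proof.
set A := jacobian F 0 => uA Ap Fp.
rewrite /averaged_map -scalemxAl mulmx_suml; congr (_ *: _).
rewrite -(@sum_cyclic_shift _ p (fun j => iter j F v *m A ^- j *m A)); last first.
  by rewrite Fp Ap expr0.
apply: eq_bigr => j _; rewrite -iterSr -mulmxA; congr (_ *m _).
by rewrite mulmxE exprS invrM ?unitrX // mulrVK.
Qed.

Theorem theorem15 (R : realType) (K : numFieldType)
    (hK : real_or_complex R K) (p : nat) (alpha : K)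
    (halpha : p.-primitive_root alpha) (f : K -> K)
    (hF : C1 (planar_map alpha f))
    (hf0 : f 0 = 0) (hf'0 : derive1 f 0 = 0) :
  ((is_periodic (planar_map alpha f) <->
      forall y : K, \sum_(j < p) alpha ^+ j * f (alpha ^+ j * y) = 0) /\
   (is_periodic (planar_map alpha f) ->
      periodic_of_period (planar_map alpha f) p)) /\
  (periodic_of_period (planar_map alpha f) p ->
     global_linearization (planar_map alpha f)
       (averaged_map p (planar_map alpha f))).
Proof.
have p_gt0 := prim_order_gt0 halpha.
have a0 := prim_root_neq0 p alpha halpha.
have sum0_period : (forall y, \sum_(j < p) alpha ^+ j * f (alpha ^+ j * y) = 0) ->
    forall v, iter p (planar_map alpha f) v = v.
  move=> S0 v; rewrite -[p in iter p]mul1n (iter_planar_map_period p) //.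
  by rewrite shear0 // planar_shift_period // S0 mulr0 mul0rn.
have periodic_sum0 : is_periodic (planar_map alpha f) ->
    forall y, \sum_(j < p) alpha ^+ j * f (alpha ^+ j * y) = 0.
  move=> [q [q_gt0 Fq]] y.
  have /dvdnP[m qE] := planar_map_period_dvd p alpha f q halpha Fq.
  (* At (0, y) the first coordinate of the iterate of order m p is m T_p(y). It vanishes, and [m] is
     nonzero because [q] is positive. *)
  have /(congr1 (fun w : 'rV_2 => w 0 0)) := Fq (y *: delta_mx 0 1).
  rewrite qE (iter_planar_map_period p) // !mxE /= planar_shift_period //.
  rewrite mulr0 add0r !mulr1 => /eqP; rewrite mulrn_eq0 mulf_eq0 invr_eq0.
  rewrite (negPf a0) /= => /orP[/eqP m0|/eqP //].
  by rewrite qE m0 in q_gt0.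
have C1f := scalar_C1_planar_map alpha f hF.
have dF0 := is_diff_planar_map0 alpha f a0 C1f hf'0.
have J0 := jacobian_is_diff 2 2 _ _ _ dF0.
split; first split.
- split=> // S0; exists p; split=> //; exact: sum0_period.
- move=> perF; split=> //; first exact/sum0_period/periodic_sum0.
  by move=> q q_gt0 /(planar_map_period_dvd p alpha f q halpha)/dvdn_leq; apply.
move=> [_ Fp _]; split; last first.
  move=> v; rewrite averaged_map_conj ?J0 ?diff_val ?planar_linear_part_unit //.
  by rewrite expmx_planar_linear_part (prim_expr_order halpha) planar_linear_part1.
rewrite (averaged_planar_map p alpha f p_gt0 a0 J0).
pose G y := \sum_(j < p) planar_shift alpha f j y.
(* The inner factor 1 gives [g] the shape required by [scalar_C1_scale]. *)
pose g y := p%:R^-1 * G (1 * y).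
have -> : (fun y => p%:R^-1 * \sum_(j < p) planar_shift alpha f j y) = g.
  by apply/funext => y; rewrite /g mul1r.
have C1g : scalar_C1 g.
  apply: scalar_C1_scale; apply: (scalar_C1_sum p (planar_shift alpha f)) => j.
  apply: (scalar_C1_sum j (fun i y => alpha ^- i.+1 * f (alpha ^- i * y))) => i.
  exact: scalar_C1_scale.
split; first exact: C1_shear.
(* The inverse is the shear by [- g], again written as a rescaling of [g] so that its regularity
   follows from [scalar_C1_scale]. *)
exists (shear (fun y => -1 * g (1 * y))); split.
- by move=> v; rewrite shear_add shear0 // mul1r mulN1r subrr.
- by move=> v; rewrite shear_add shear0 // mul1r mulN1r addNr.
- exact/C1_shear/scalar_C1_scale.
Qed.
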